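(* Let $\Omega\subset\mathbb{R}^n$ be a bounded Borel set and let $\mu\in\mathrm{ba}(\Omega,\mathcal{B}(\Omega),\mathcal{L}^n)$. Then there exists a (signed) Radon measure $\sigma$ supported on $\operatorname{core}\mu\subset\overline{\Omega}$ such that for every $\phi\in C_e(\Omega)$ $$\int_\Omega\phi\,d\mu=\int_{\operatorname{core}\mu}\phi\,d\sigma .$$
   Context: $\mathcal{B}(\Omega)$ is the Borel $\sigma$-algebra of $\Omega$ and $\mathcal{L}^n$ is Lebesgue measure. A measure is a finitely additive real-valued set function. $\mathrm{ba}(\Omega,\mathcal{B}(\Omega),\mathcal{L}^n)$ is the set of bounded measures $\mu$ on $\mathcal{B}(\Omega)$ such that $\mathcal{L}^n(B)=0$ implies $\mu(B)=0$ for all $B\in\mathcal{B}(\Omega)$; $|\mu|$ is the total variation. The core of $\mu$ is $\operatorname{core}\mu:=\{x\in\mathbb{R}^n:|\mu|(V\cap\Omega)>0\text{ for all open }V\subset\mathbb{R}^n\text{ with }x\in V\}$. $C_e(\Omega)$ is the space of continuous functions on $\Omega$ which extend to continuous functions on $\overline{\Omega}$ (equivalently, restrictions to $\Omega$ of continuous functions on $\overline{\Omega}$). Integrals over subsets of $\overline\Omega$ are those of the continuous extension to $\overline{\Omega}$. For bounded measurable $f$, $\int_\Omega f\,d\mu:=\lim_k\int_\Omega s_k\,d\mu$, where $s_k$ are simple functions converging to $f$ in measure $|\mu|$ (i.e. $|\mu|^*\{|s_k-f|>\varepsilon\}\to0$ for all $\varepsilon>0$, with $|\mu|^*(B)=\inf\{|\mu|(A):A\in\mathcal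 B(\Omega),B\subset A\}$) and with $\int_\Omega|s_k-s_l|\,d|\mu|\to0$. Radon measures here are countably additive, real-valued (possibly signed) regular Borel measures. *)

(* Defs.v *)
From HB Require Import structures.
From mathcomp Require Import all_boot all_order all_algebra.
From mathcomp Require Import all_classical all_reals all_analysis.

Set Implicit Arguments.
Unset Strict Implicit.
Unset Printing Implicit Defensive.

Import Order.TTheory GRing.Theory Num.Theory.
Import numFieldNormedType.Exports.
Import HBSimple.

Local Open Scope classical_set_scope.
Local Open Scope ring_scope.

(* R^n with its Borel sigma-algebra. The carrier is convertible to 'rV[R]_n,
   which has the topology of the sup norm, i.e. the usual one. *)
Notation borelRn R n := (g_sigma_algebraType (@open 'rV[R]_n)).

Definition borel (R : realType) (n : nat) (A : set 'rV[R]_n) : Prop :=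
  measurable (A : set (borelRn R n)).

(* Lebesgue measure on the Borel sets of R^n, as the n-fold product of the
   one-dimensional Lebesgue measure: L^{n+1}(A) is the integral over t of the
   L^n measure of the section {x | (t, x) \in A}. *)
Fixpoint lebesgueRn (R : realType) (n : nat) : set 'rV[R]_n -> \bar R :=
  match n return set 'rV[R]_n -> \bar R with
  | 0%N => fun A => (\1_A (0 : 'rV[R]_0))%:E
  | m.+1 => fun A =>
      (\int[lebesgue_measure]_(t in [set: R])
         lebesgueRn [set x : 'rV[R]_m | A (row_mx (t%:M : 'rV[R]_1) x)])%E
  end.

Section bounded_additive.
Context (R : realType) (n : nat).
Implicit Types (Omega A B : set 'rV[R]_n) (mu : set 'rV[R]_n -> R).

(* B(Omega) for a Borel set Omega *)
Definition borel_in Omega A : Prop := borel A /\ A `<=` Omega.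

(* Set functions on B(Omega) are given by functions on all of set 'rV[R]_n;
   only the values on B(Omega) matter, here and in all definitions below. *)
Record ba Omega mu : Prop := Ba {
  ba_additive : forall A B, borel_in Omega A -> borel_in Omega B ->
    A `&` B = set0 -> mu (A `|` B) = mu A + mu B ;
  ba_bounded : exists M : R, forall A, borel_in Omega A -> `|mu A| <= M ;
  ba_null : forall A, borel_in Omega A -> lebesgueRn A = 0%E -> mu A = 0 }.

Definition ba_variation mu A : \bar R :=
  ereal_sup [set s | exists (k : nat) (F : nat -> set 'rV[R]_n),
    [/\ forall i, borel (F i), trivIset `I_k F, \bigcup_(i in `I_k) F i = A &
        s = (\sum_(i < k) `|mu (F i)|)%:E]].

Definition core Omega mu : set 'rV[R]_n :=
  [set x | forall V : set 'rV[R]_n, open V -> V x ->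
     (0 < ba_variation mu (V `&` Omega))%E].

Definition outer_variation Omega mu B : \bar R :=
  ereal_inf [set ba_variation mu A | A in
    [set A | borel_in Omega A /\ B `<=` A]].

(* Integral over Omega of a simple function with respect to a set function on
   B(Omega). Simple functions on Omega are restrictions of Borel simple
   functions on R^n, since Omega is Borel. *)
Definition simple_integral Omega (nu : set 'rV[R]_n -> \bar R)
    (s : 'rV[R]_n -> R) : \bar R :=
  sintegral (fun A => nu (Omega `&` A)) s.

Definition is_ba_integral Omega mu (f : 'rV[R]_n -> R) (I : R) : Prop :=
  exists s : nat -> {sfun borelRn R n >-> R},
  [/\ (forall e : R, 0 < e ->
        outer_variation Omega mu [set x | Omega x /\ e < `|s k x - f x|]
          @[k --> \oo] --> 0%E),
      (forall e : R, 0 < e -> \forall k & l \near \oo,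
        (simple_integral Omega (ba_variation mu)
           (fun x => `|s k x - s l x|%R) < e%:E)%E) &
      simple_integral Omega (fun A => (mu A)%:E) (s k)
        @[k --> \oo] --> I%:E].

Definition ba_integral Omega mu (f : 'rV[R]_n -> R) : R :=
  get [set I | is_ba_integral Omega mu f I].

Definition continuous_extension Omega (phi psi : 'rV[R]_n -> R) : Prop :=
  {within closure Omega, continuous psi} /\
  (forall x, Omega x -> psi x = phi x).

Definition Ce Omega : set ('rV[R]_n -> R) :=
  [set phi | {within Omega, continuous phi} /\
     exists psi, continuous_extension Omega phi psi].

End bounded_additive.

Section signed_integral.
Context d (T : measurableType d) (R : realType).
Variable sigma : {charge set T -> \bar R}.

Lemma hahn_exists :
  exists PN : set T * set T, hahn_decomposition sigma PN.1 PN.2.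
Proof. by have [P [N PN]] := Hahn_decomposition sigma; exists (P, N). Qed.

(* By Hahn_decomposition_uniq, the Jordan decomposition does not depend on the
   Hahn decomposition chosen here. *)
Definition hahn := projT2 (cid hahn_exists).

Definition signed_variation : set T -> \bar R := charge_variation hahn.

Definition charge_integral (D : set T) (f : T -> R) : \bar R :=
  (\int[jordan_pos hahn]_(x in D) (f x)%:E -
   \int[jordan_neg hahn]_(x in D) (f x)%:E)%E.

End signed_integral.

Section radon.
Context (R : realType) (n : nat).
Variable sigma : {charge set (borelRn R n) -> \bar R}.

(* Countable additivity and finiteness are part of the type of sigma; what
   remains is regularity of |sigma|, inner by compact and outer by open sets. *)
Definition radon : Prop :=
  forall B : set 'rV[R]_n, borel B -> forall e : R, 0 < e ->
  exists K U : set 'rV[R]_n, [/\ compact K, open U, K `<=` B, B `<=` U &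
    (signed_variation sigma (U `\` K) < e%:E)%E].

Definition supported_on (D : set 'rV[R]_n) : Prop :=
  signed_variation sigma (~` D) = 0%E.

End radon.

(* Main.v *)
(* Write mu = |mu| - (|mu| - mu): both terms are nonnegative finitely additive
   contents nu on the Borel sets. The outer measure obtained from nu by first
   approximating open sets from inside by compact sets and then arbitrary sets
   from outside by open sets is countably additive on Borel sets (Caratheodory);
   the resulting measure lam satisfies nu K <= lam K for compact K and
   lam U <= nu U for open U. For psi continuous on the compact set closure
   Omega, the sets {psi >= t_i} are compact, contained in the open sets
   {psi > t_(i-1)}, hence the values nu {psi >= t_i} and lam {psi >= t_i}
   interlace, and a telescoping sum shows that nu and lam integrate psi to the
   same value. Compact subsets of the complement of the core are |mu|-null, so
   lam lives on the core. *)

Require Import Defs.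
From HB Require Import structures.
From mathcomp Require Import all_boot all_order all_algebra.
From mathcomp Require Import all_classical all_reals all_analysis.
From mathcomp Require Import ring lra.

Set Implicit Arguments.
Unset Strict Implicit.
Unset Printing Implicit Defensive.

Import Order.TTheory GRing.Theory Num.Theory.
Import numFieldNormedType.Exports.

Local Open Scope classical_set_scope.
Local Open Scope ring_scope.

(** * Finitely additive contents and Radon measures *)

(** Finite additivity lets mass escape: a content on [(0, 1)] that gives every interval [(0, d)]
    full mass has core [{0}], outside its domain. So [nu K < lam K] may happen, the two set
    functions are comparable only on compact and on open sets, and equality of integrals can be
    expected only for integrands whose level sets fit this comparison. For the same reason the
    complement of the core need not be [|mu|]-null; its null compact subsets suffice because [lam]
    of an open set is a supremum over compact subsets. The pair [|mu|], [|mu| - mu] replaces the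
    Jordan decomposition of [mu]: nonnegativity follows from [|mu A| <= |mu| A], and the missing
    minimality does no harm, since only the difference of the two measures matters. The integral
    against [mu] is a limit along an arbitrary sequence converging in measure, and [ba_integral]
    picks some such limit. Its value is therefore pinned down by comparison with simple functions
    that approximate uniformly. *)

Notation borelType T := (g_sigma_algebraType (@open T)).

Section borel_sets.
Context (T : ptopologicalType).

Lemma open_borel (U : set T) : open U -> measurable (U : set (borelType T)).
Proof. by move=> oU; exact: sub_sigma_algebra. Qed.

Lemma closed_borel (F : set T) : closed F -> measurable (F : set (borelType T)).
Proof.
move=> cF; rewrite -(setCK F).
by apply: (@measurableC _ (borelType T)); apply: open_borel; rewrite openC.
Qed.

Lemma compact_borel (K : set T) :
  hausdorff_space T -> compact K -> measurable (K : set (borelType T)).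
Proof. by move=> hT cK; apply: closed_borel; exact: compact_closed. Qed.

End borel_sets.

Section finitely_additive.
Context d (T : measurableType d) (R : realType).

Definition finitely_additive (m : set T -> R) :=
  forall A B, measurable A -> measurable B -> A `&` B = set0 ->
    m (A `|` B) = m A + m B.

Variable m : set T -> R.
Hypothesis m_add : finitely_additive m.

Lemma fa_set0 : m set0 = 0.
Proof.
have := m_add measurable0 measurable0 (setI0 set0).
by rewrite setU0 => /eqP; rewrite addrC -subr_eq subrr eq_sym => /eqP.
Qed.

Lemma fa_setDI A B : measurable A -> measurable B ->
  m A = m (A `\` B) + m (A `&` B).
Proof.
move=> mA mB; rewrite -m_add.
- by rewrite setUC setUIDK.
- exact: measurableD.
- exact: measurableI.
- by rewrite setDE setIACA setICl setI0.
Qed.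

Hypothesis m_ge0 : forall A, measurable A -> 0 <= m A.

Lemma fa_le A B : measurable A -> measurable B -> A `<=` B -> m A <= m B.
Proof.
move=> mA mB AB; rewrite (fa_setDI mB mA) setIidr //.
by rewrite lerDr m_ge0 //; exact: measurableD.
Qed.

Lemma fa_leU A B : measurable A -> measurable B -> m (A `|` B) <= m A + m B.
Proof.
move=> mA mB; rewrite (fa_setDI (measurableU _ _ mA mB) mA) addrC.
have mU := measurableU _ _ mA mB.
apply: lerD; apply: fa_le => //; do ?[exact: measurableD | exact: measurableI].
by move=> x [[Ax|//] /(_ Ax)].
Qed.

End finitely_additive.

Section content_to_measure.
Context (T : ptopologicalType) (R : realType).
Hypotheses (hT : hausdorff_space T) (nT : normal_space T).
Local Notation B := (borelType T).
Variable nu : set B -> R.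
Hypothesis nu_add : finitely_additive nu.
Hypothesis nu_ge0 : forall A, measurable A -> 0 <= nu A.
Local Open Scope ereal_scope.

Let inner (U : set T) : \bar R :=
  ereal_sup [set (nu K)%:E | K in [set K : set T | compact K /\ K `<=` U]].

Let outer (A : set T) : \bar R :=
  ereal_inf [set inner U | U in [set U : set T | open U /\ A `<=` U]].

Let nu_le (K L : set T) : measurable (K : set B) -> measurable (L : set B) ->
  K `<=` L -> (nu K <= nu L)%R.
Proof. exact: fa_le. Qed.

Let cpt_borel (K : set T) : compact K -> measurable (K : set B).
Proof. exact: compact_borel. Qed.

Let inner_ge (K U : set T) : compact K -> K `<=` U -> (nu K)%:E <= inner U.
Proof. by move=> cK KU; apply: ereal_sup_ubound; exists K. Qed.

Let inner_ge0 U : 0 <= inner U.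
Proof.
apply: le_trans (inner_ge (@compact0 T) (@sub0set _ U)).
by rewrite lee_fin nu_ge0.
Qed.

Let inner_mono U V : U `<=` V -> inner U <= inner V.
Proof.
move=> UV; apply: ge_ereal_sup => _ [K [cK KU] <-].
by apply: inner_ge => //; exact: subset_trans UV.
Qed.

Let inner_le_nu (U : set T) :
  measurable (U : set B) -> inner U <= (nu U)%:E.
Proof.
move=> mU; apply: ge_ereal_sup => _ [K [cK KU] <-].
by rewrite lee_fin; apply: nu_le => //; exact: cpt_borel.
Qed.

Let inner_fin U : inner U \is a fin_num.
Proof.
rewrite ge0_fin_numE//; apply: (@le_lt_trans _ _ (nu setT)%:E);
  last exact: ltry.
by apply: le_trans (inner_le_nu measurableT); exact: inner_mono.
Qed.

Let outer_open U : open U -> outer U = inner U.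
Proof.
move=> oU; apply/eqP; rewrite eq_le; apply/andP; split.
  by apply: ereal_inf_lbound; exists U => //; split.
by apply: le_ereal_inf_tmp => _ [V [oV UV] <-]; exact: inner_mono.
Qed.

(* Normality splits a compact subset of [U `|` V] into a compact part in [U] and
   one in [V]. *)
Let innerU2 U V : open U -> open V -> inner (U `|` V) <= inner U + inner V.
Proof.
move=> oU oV; apply: ge_ereal_sup => _ [K [cK KUV] <-].
have clK : closed K by exact: compact_closed.
have clD W : open W -> closed (K `\` W).
  by move=> oW; rewrite setDE; apply: closedI => //; rewrite closedC.
have disj : (K `\` U) `&` (K `\` V) = set0.
  by apply/seteqP; split => // x [[/KUV[Ux|Vx] nUx] [_ nVx]]; exfalso;
    [exact: nUx|exact: nVx].
have [U' [V' [oU' oV' KU' KV' UV0]]] := (@normal_openP R T).1 nT _ _ (clD _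
  oU) (clD _ oV) disj.
have cD W : open W -> compact (K `\` W).
  by move=> oW; apply: (subclosed_compact _ cK); [exact: clD|exact: subDsetl].
have KE : K = (K `\` U') `|` (K `\` V').
  apply/seteqP; split => [x Kx|x [[]|[]]//].
  have [U'x|] := pselect (U' x); last by left.
  right; split => // V'x; suff : set0 x by [].
  by rewrite -UV0.
apply: (@le_trans _ _ (nu (K `\` U') + nu (K `\` V'))%:E).
  rewrite lee_fin {1}KE; apply: (fa_leU nu_add nu_ge0); apply: cpt_borel;
    exact: cD.
rewrite EFinD; apply: leeD; apply: inner_ge; do ?exact: cD.
  by move=> x [Kx nU'x]; apply: contrapT => nUx; apply: nU'x; apply: KU'.
by move=> x [Kx nV'x]; apply: contrapT => nVx; apply: nV'x; apply: KV'.
Qed.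

(** Compactness reduces the countable open cover of [K] to a finite subunion, where [innerU2]
    applies by induction. This is where countable subadditivity enters, although [nu] is only
    finitely additive. *)
Let inner_bigcup (U : (set T)^nat) : (forall i, open (U i)) ->
  inner (\bigcup_i U i) <= \sum_(i <oo) inner (U i).
Proof.
move=> oU; apply: ge_ereal_sup => _ [K [cK KU] <-].
have fin n : inner (\big[setU/set0]_(i < n) U i) <= \sum_(i < n) inner (U i).
  elim: n => [|n IH].
    rewrite !big_ord0; apply: ge_ereal_sup => _ [L [_ L0] <-].
    by move: L0; rewrite subset0 => ->; rewrite (fa_set0 nu_add).
  rewrite !big_ord_recr/=; apply: le_trans (leeD2r _ IH).
  apply: innerU2 => //; elim/big_ind : _ => //; [exact: open0|exact: openU].
(* Compactness in its near-covering form: if [x] lies in [U i], then all points of [U i] lie in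
   every partial union with more than [i] terms, so one partial union contains [K]. *)
have : \forall n \near \oo, K `<=` [set x | (\big[setU/set0]_(i < n) U i) x].
  have /compact_near_coveringP := cK; apply => x /KU [i _ Uix].
  exists (U i, [set n | (i < n)%N]) => /=.
    split; first exact: open_nbhs_nbhs.
    by exists i.+1.
  move=> [y n] /= [Uiy lin]; rewrite -bigcup_mkord.
  by exists i.
move=> [n _ /(_ n (leqnn _)) Kn].
apply: le_trans (inner_ge cK Kn) _; apply: le_trans (fin n) _.
rewrite -(big_mkord xpredT (fun i => inner (U i))).
exact: nneseries_lim_ge.
Qed.

Let outer0 : outer set0 = 0.
Proof.
rewrite outer_open; last exact: open0.
apply/eqP; rewrite eq_le inner_ge0 andbT.
by apply: le_trans (inner_le_nu measurable0) _; rewrite (fa_set0 nu_add).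
Qed.

Let outer_ge0 A : 0 <= outer A.
Proof. by apply: le_ereal_inf_tmp => _ [V _ <-]. Qed.

Let outer_le : {homo outer : A B / A `<=` B >-> A <= B}.
Proof.
move=> A A' AA'; apply: le_ereal_inf_tmp => _ [V [oV AV] <-].
by apply: ereal_inf_lbound; exists V => //; split => //; exact: subset_trans AV.
Qed.

Let outer_fin A : outer A \is a fin_num.
Proof.
rewrite ge0_fin_numE//; apply: (@le_lt_trans _ _ (outer setT)).
  exact: outer_le.
rewrite outer_open; last exact: openT.
by rewrite -ge0_fin_numE.
Qed.

Let outer_approx A (e : R) : (0 < e)%R ->
  exists U, [/\ open U, A `<=` U & inner U <= outer A + e%:E].
Proof.
move=> e0; have [_ [U [oU AU] <-] lt] := lb_ereal_inf_adherent e0 (outer_fin A).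
by exists U; split => //; exact: ltW.
Qed.

Let outer_subadd : sigma_subadditive outer.
Proof.
move=> F; apply/lee_addgt0Pr => e e0.
have de i : (0 < e / (2 ^ i.+1)%:R)%R by rewrite divr_gt0// ltr0n expn_gt0.
have /choice[U HU] i := outer_approx (F i) (de i).
have oU i : open (U i) by have [] := HU i.
apply: le_trans (epsilon_trick xpredT _ (ltW e0)) => //.
apply: (@le_trans _ _ (\sum_(i <oo) inner (U i))); last first.
  by apply: lee_nneseries => // i _; have [] := HU i.
apply: le_trans (inner_bigcup oU).
apply: ereal_inf_lbound; exists (\bigcup_i U i) => //; split.
  exact: bigcup_open.
by apply: subset_bigcup => i _; have [] := HU i.
Qed.

Let outer_mea : {outer_measure set T -> \bar R} :=
  HB.pack outer (isOuterMeasure.Build R T outer outer0 outer_ge0 outer_le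
    outer_subadd).

(* For [V] open, exhaust [V `&` U] by a compact [K], then [V `\` K] by a compact
   [L]: [K `|` L] is a compact subset of [V] of nearly full content. *)
Let open_caratheodory U : open U -> outer_mea.-caratheodory U.
Proof.
move=> oU; apply: le_caratheodory_measurable => A.
apply: le_ereal_inf_tmp => _ [V [oV AV] <-].
apply: (@le_trans _ _ (outer (V `&` U) + outer (V `\` U))).
  by apply: leeD; apply: outer_le; [exact: setSI|exact: setSD].
apply/lee_addgt0Pr => e e0.
have oVU : open (V `&` U) by exact: openI.
rewrite (outer_open oVU).
have e20 : (0 < e / 2)%R by rewrite divr_gt0.
have [_ [K [cK KVU] <-] ltK] := ub_ereal_sup_adherent e20 (inner_fin (V `&` U)).
have oVK : open (V `\` K).
  by rewrite setDE; apply: openI => //; rewrite openC; exact: compact_closed.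
have [_ [L [cL LVK] <-] ltL] := ub_ereal_sup_adherent e20 (inner_fin (V `\` K)).
have leV : outer (V `\` U) <= inner (V `\` K).
  rewrite -(outer_open oVK); apply: outer_le => x [Vx nUx];
    split => // /KVU[] //.
have KL : (nu K)%:E + (nu L)%:E <= inner V.
  rewrite -EFinD -nu_add; do ?exact: cpt_borel.
    apply: inner_ge; first exact: compactU.
    by move=> x [/KVU[]|/LVK[]].
  by apply/seteqP; split => // x [Kx /LVK[]].
apply: le_trans (leeD2r _ KL).
rewrite [e]splitr EFinD addeACA.
apply: leeD; last apply: (le_trans leV).
  by rewrite -leeBlDr// ltW.
by rewrite -leeBlDr// ltW.
Qed.

Let borel_caratheodory A : measurable (A : set B) ->
  measurable (A : set (caratheodory_type outer_mea)).
Proof.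
apply: smallest_sub; last by move=> U oU; exact: open_caratheodory.
exact: (@sigma_algebra_measurable _ (caratheodory_type outer_mea)).
Qed.

Let lam : set B -> \bar R := outer.

Let lam_sigma_additive : semi_sigma_additive lam.
Proof.
move=> F mF tF mUF.
apply: (caratheodory_measure_sigma_additive (mu := outer_mea)) => //.
  by move=> i; exact: borel_caratheodory.
exact: borel_caratheodory.
Qed.

Let lam_fin : fin_num_fun lam.
Proof. by move=> A _; exact: outer_fin. Qed.

Let lam_measure : {measure set B -> \bar R} := HB.pack lam
  (isMeasure.Build _ B R lam outer0 outer_ge0 lam_sigma_additive).

Let lam_finite_measure : {finite_measure set B -> \bar R} := 
  HB.pack (Measure.sort lam_measure)
    (Measure_isFinite.Build _ B R (Measure.sort lam_measure) lam_fin).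

(** The bound on open sets is stated through any [r] dominating [nu] on compact subsets: [r = nu U]
    gives [lam U <= nu U], and [r = 0] shows that an open set is [lam]-null once its compact subsets
    are [nu]-null, even if [nu U > 0]. *)
Lemma content_to_measure : exists lam : {finite_measure set B -> \bar R},
  [/\ forall K : set T, compact K -> (nu K)%:E <= lam K,
      forall (U : set T) (r : R), open U ->
        (forall K, compact K -> K `<=` U -> (nu K <= r)%R) -> lam U <= r%:E &
      forall (A : set T) (e : R), measurable (A : set B) -> (0 < e)%R ->
        exists U : set T, [/\ open U, A `<=` U & lam U <= lam A + e%:E]].
Proof.
exists lam_finite_measure; split.
- move=> K cK; apply: le_ereal_inf_tmp => _ [V [oV KV] <-]; exact: inner_ge.
- move=> U r oU H; rewrite [leLHS](outer_open oU).
  by apply: ge_ereal_sup => _ [K [cK KU] <-]; rewrite lee_fin; exact: H.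
- move=> A e mA e0; have [U [oU AU le]] := outer_approx A e0.
  by exists U; split => //; rewrite [leLHS](outer_open oU).
Qed.

End content_to_measure.

(** * Integration of simple functions against a content *)

Section simple_functions.
Context d (T : measurableType d).

(** Values lie in an arbitrary type so that a pair of simple functions is again simple. Statements
    about two functions then reduce to one partition, the fibres of the pair. *)
Definition simple (Y : Type) (f : T -> Y) :=
  finite_set (range f) /\ forall y, measurable (f @^-1` [set y]).

Lemma simple_preimage (Y : choiceType) (f : T -> Y) (A : set Y) :
  simple f -> measurable (f @^-1` A).
Proof.
move=> [finf mf].
have -> : f @^-1` A = \bigcup_(y in range f `&` A) (f @^-1` [set y]).
  apply/seteqP; split => [x Afx|x [y [_ Ay] fxy]]; last first.
    by rewrite /preimage/= fxy.
  by exists (f x) => //; split => //; exists x.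
by apply: fin_bigcup_measurable => // ; exact: finite_setIl.
Qed.

Lemma simple_comp (X Y : choiceType) (F : X -> Y) (f : T -> X) :
  simple f -> simple (F \o f).
Proof.
move=> sf; split; last first.
  by move=> y; rewrite comp_preimage; exact: simple_preimage.
by rewrite -(image_comp f F); apply: finite_image; case: sf.
Qed.

Lemma simple_pair (X Y : choiceType) (f : T -> X) (g : T -> Y) :
  simple f -> simple g -> simple (fun x => (f x, g x)).
Proof.
move=> [finf mf] [fing mg]; split.
  apply: (@sub_finite_set _ _ (range f `*` range g)); last exact: finite_setX.
  by move=> _ [x _ <-]; split; exists x.
move=> [a b].
have -> : (fun x => (f x, g x)) @^-1` [set (a, b)] =
    f @^-1` [set a] `&` g @^-1` [set b].
  by apply/seteqP; split => [x [<- <-]|x /= [-> ->]].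
exact: measurableI.
Qed.

Lemma simple_comp2 (X Y Z : choiceType) (F : X -> Y -> Z) f g :
  simple f -> simple g -> simple (fun x => F (f x) (g x)).
Proof.
move=> sf sg; exact: (simple_comp (fun p => F p.1 p.2) (simple_pair sf sg)).
Qed.

Lemma simple_cst (Y : choiceType) (y : Y) : simple (fun=> y).
Proof.
split; first by apply: (@sub_finite_set _ _ [set y]) => // _ [x _ <-].
by move=> z; rewrite preimage_cst; case: ifPn.
Qed.

Lemma simple_mem (A : set T) : measurable A -> simple (fun x => x \in A).
Proof.
move=> mA; split; first exact: finite_finset.
move=> [].
- have -> // : (fun x => x \in A) @^-1` [set true] = A.
  by apply/seteqP; split => x /=; rewrite -?[_ = true]/(is_true _) inE.
- have -> : (fun x => x \in A) @^-1` [set false] = ~` A.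
  apply/seteqP; split => x /=; first by move/negbT; rewrite notin_setE.
  by move=> nAx; apply/negbTE; rewrite notin_setE.
  exact: measurableC.
Qed.

Section real_valued.
Context (R : realType).

Lemma simple_sum I (r : seq I) (F : I -> T -> R) :
  (forall i, simple (F i)) -> simple (fun x => \sum_(i <- r) F i x).
Proof.
move=> sF; elim: r => [|j r IH].
  by under eq_fun do rewrite big_nil; exact: simple_cst.
under eq_fun do rewrite big_cons.
exact: (simple_comp2 (fun x y => x + y)).
Qed.

Lemma simple_indic (A : set T) : measurable A -> simple (\1_A : T -> R).
Proof.
by move=> mA; apply: (simple_comp (fun b : bool => b%:R : R));
  exact: simple_mem.
Qed.

Import HBSimple.

Lemma sfun_simple (s : {sfun T >-> R}) : simple s.
Proof.
split; first exact: fimfunP.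
by move=> y; exact: measurable_sfunP.
Qed.

Lemma simple_sfun (f : T -> R) : simple f ->
  exists s : {sfun T >-> R}, s = f :> (T -> R).
Proof.
move=> sf.
have mf : measurable_fun setT f.
  by move=> _ Y mY; rewrite setTI; exact: simple_preimage.
have Pf : f \in (@sfun _ T R).
  by apply/andP; split; rewrite inE //=; case: sf.
by exists (sfun_Sub Pf).
Qed.

End real_valued.

End simple_functions.

Section finitely_additive_integral.
Context d (T : measurableType d) (R : realType).

(** A real-valued [sintegral], so that signed contents can be subtracted freely. For simple [s] and
    finitely additive [m] the sum over all of [R] has finite support, since empty fibres have
    content 0. *)
Definition sint (m : set T -> R) (s : T -> R) : R :=
  \sum_(x \in [set: R]) x * m (s @^-1` [set x]).

Section theory.
Variable m : set T -> R.
Hypothesis m_add : finitely_additive m.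

Lemma fa_preimage (Y : choiceType) (g : T -> Y) (r : seq Y) (P : pred Y) :
  simple g -> uniq r ->
  m (g @^-1` [set y | y \in r /\ P y]) = \sum_(y <- r | P y) m (g @^-1` [set
    y]).
Proof.
move=> sg; elim: r => [_|y r IH /= /andP[yr ur]].
  rewrite big_nil -[RHS](fa_set0 m_add); congr m.
  by apply/seteqP; split => x //= -[].
rewrite big_cons; case: ifPn => Py.
  rewrite -IH // -m_add; do ?exact: simple_preimage.
    congr m; apply/seteqP; split => x /=.
      by rewrite inE => -[/orP[/eqP ->|? ?]]; [left|right].
    by move=> [->|[? ?]]; rewrite inE ?eqxx //=; split=> //; apply/orP; right.
  apply/seteqP; split => x //= [->] [yr' _].
  by rewrite yr' in yr.
rewrite -IH //; congr m; apply/seteqP; split => x /=.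
  by rewrite inE => -[/orP[/eqP ->|//]]; rewrite (negbTE Py).
by move=> [? ?]; rewrite inE; split => //; apply/orP; right.
Qed.

(** The fibres of [g] refine the level sets of [F \o g], and finite additivity regroups the terms.
    With [g] the pair of two simple functions, linearity and monotonicity become termwise
    statements. *)
Lemma sint_comp (Y : choiceType) (g : T -> Y) (r : seq Y) (F : Y -> R) :
  simple g -> uniq r -> (forall x, g x \in r) ->
  sint m (F \o g) = \sum_(y <- r) F y * m (g @^-1` [set y]).
Proof.
move=> sg ur gr; rewrite /sint.
rewrite -(@fsbig_widen _ _ _ _ [set` undup (map F r)])//; last first.
  move=> x [_ /= xr]; rewrite (_ : _ @^-1` _ = set0) ?(fa_set0 m_add) ?mulr0//.
  apply/seteqP; split => // t /= Fgt; apply: xr.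
  by rewrite mem_undup -Fgt; exact: map_f.
rewrite -fsbig_seq ?undup_uniq//.
transitivity (\sum_(x <- undup (map F r)) \sum_(y <- r | F y == x)
    F y * m (g @^-1` [set y])).
  apply: eq_bigr => x _.
  rewrite (_ : (F \o g) @^-1` [set x] =
      g @^-1` [set y | y \in r /\ F y == x]); last first.
    apply/seteqP; split => t /=; first by move=> <-; split.
    by move=> [_ /eqP].
  by rewrite fa_preimage// mulr_sumr; apply: eq_bigr => y /eqP ->.
under eq_bigr do rewrite big_mkcond.
rewrite exchange_big/=; apply: eq_big_seq => y yr.
rewrite -big_mkcond/= (eq_bigl (pred1 (F y))) => [|x]; last exact: eq_sym.
by rewrite -big_filter filter_pred1_uniq ?undup_uniq ?mem_undup ?map_f//
  big_seq1.
Qed.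

Lemma simple_range_seq (Y : choiceType) (g : T -> Y) : simple g ->
  exists r : seq Y, uniq r /\ forall x, g x \in r.
Proof.
move=> [/finite_seqP[r rE] _]; exists (undup r); split; first exact: undup_uniq.
move=> x; rewrite mem_undup.
have : range g (g x) by exists x.
by rewrite rE.
Qed.

Lemma sintD f g : simple f -> simple g ->
  sint m (fun x => f x + g x) = sint m f + sint m g.
Proof.
move=> sf sg; have sfg := simple_pair sf sg.
have [r [ur fgr]] := simple_range_seq sfg.
rewrite (sint_comp (fun p => p.1 + p.2) sfg ur fgr).
rewrite (sint_comp (fun p => p.1) sfg ur fgr) (sint_comp (fun p => p.2) sfg ur
  fgr).
by rewrite -big_split/=; apply: eq_bigr => y _; rewrite mulrDl.
Qed.

Lemma sintZ c f : simple f -> sint m (fun x => c * f x) = c * sint m f.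
Proof.
move=> sf; have [r [ur fr]] := simple_range_seq sf.
rewrite (sint_comp (fun y => c * y) sf ur fr) (sint_comp id sf ur fr).
by rewrite mulr_sumr; apply: eq_bigr => y _; rewrite mulrA.
Qed.

Lemma sint_indic A : measurable A -> sint m \1_A = m A.
Proof.
move=> mA.
have -> : (\1_A : T -> R) = (fun b : bool => b%:R) \o (fun x => x \in A) by [].
rewrite (sint_comp _ (simple_mem mA) (r := [:: true; false]))//; last first.
  by move=> x; case: (x \in A).
rewrite 2!big_cons big_nil mul0r mul1r !addr0; congr m.
by apply/seteqP; split => x /=; rewrite -?[_ = true]/(is_true _) inE.
Qed.

Lemma sint_cst c : sint m (fun=> c) = c * m setT.
Proof.
rewrite -(sint_indic measurableT) -sintZ; last exact: simple_indic.
by congr sint; apply/funext => x; rewrite indicT mulr1.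
Qed.

Lemma sintB f g : simple f -> simple g ->
  sint m (fun x => f x - g x) = sint m f - sint m g.
Proof.
move=> sf sg; rewrite -[in RHS]mulN1r -sintZ// -sintD//.
  by congr sint; apply/funext => x; rewrite mulN1r.
exact: (simple_comp (fun y => -1 * y)).
Qed.

Lemma sint_sum I (r : seq I) (F : I -> T -> R) : (forall i, simple (F i)) ->
  sint m (fun x => \sum_(i <- r) F i x) = \sum_(i <- r) sint m (F i).
Proof.
move=> sF; elim: r => [|i r IH].
  under eq_fun do rewrite big_nil.
  by rewrite big_nil sint_cst mul0r.
under eq_fun do rewrite big_cons.
rewrite big_cons sintD ?IH//; exact: simple_sum.
Qed.

End theory.

Lemma sint_norm_le (m v : set T -> R) f :
  finitely_additive m -> finitely_additive v ->
  (forall A, measurable A -> `|m A| <= v A) -> simple f ->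
  `|sint m f| <= sint v (fun x => `|f x|).
Proof.
move=> m_add v_add mv sf; have [r [ur fr]] := simple_range_seq sf.
rewrite (sint_comp m_add id sf ur fr) (sint_comp v_add Num.norm sf ur fr).
apply: le_trans (ler_norm_sum _ _ _) _; apply: ler_sum => y _.
by rewrite normrM ler_wpM2l// mv//; case: sf.
Qed.

(** A cell of the common partition either meets [X], where the values are ordered, or lies in the
    null complement of [X]. *)
Lemma le_sint (m : set T -> R) (X : set T) f g : finitely_additive m ->
  (forall A, measurable A -> 0 <= m A) -> measurable X -> m (~` X) = 0 ->
  simple f -> simple g -> (forall x, X x -> f x <= g x) ->
  sint m f <= sint m g.
Proof.
move=> m_add m_ge0 mX mX0 sf sg fg; have sfg := simple_pair sf sg.
have [r [ur fgr]] := simple_range_seq sfg.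
rewrite (sint_comp m_add (fun p => p.1) sfg ur fgr).
rewrite (sint_comp m_add (fun p => p.2) sfg ur fgr).
apply: ler_sum => -[a b] _ /=; set A := _ @^-1` _.
have mA : measurable A by exact: sfg.2.
have [[x [Xx [fa gb]]]|nX] := pselect (exists x, X x /\ A x).
  by rewrite ler_wpM2r ?m_ge0// -fa -gb fg.
suff -> : m A = 0 by rewrite !mulr0.
apply/eqP; rewrite eq_le m_ge0// andbT -mX0; apply: fa_le => //.
  exact: measurableC.
by move=> x Ax Xx; apply: nX; exists x.
Qed.

End finitely_additive_integral.

(** * The total variation of a bounded additive measure *)

Section variation.
Context (R : realType) (n : nat).
Variables (Omega : set 'rV[R]_n) (mu : set 'rV[R]_n -> R).
Hypotheses (bO : borel Omega) (mu_ba : ba Omega mu).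
Local Notation B := (borelRn R n).

(** [mu] is meaningful only on Borel subsets of [Omega]; intersecting with [Omega] turns it into a
    finitely additive function on all Borel sets. *)
Definition trace_content (A : set B) : R := mu (Omega `&` A).

Definition variation_content (A : set B) : R :=
  fine (ba_variation mu (Omega `&` A)).

Let borel_inI (A : set B) : measurable A -> borel_in Omega (Omega `&` A).
Proof.
by move=> mA; split; [exact: (@measurableI _ B)|exact: subIsetl].
Qed.

Lemma trace_content_add : finitely_additive trace_content.
Proof.
move=> A A' mA mA' AA'; rewrite /trace_content setIUr.
apply: (ba_additive mu_ba); do ?exact: borel_inI.
by rewrite setIACA AA' setI0.
Qed.

(** A sum of values of [mu] over selected disjoint pieces is itself one value of [mu], at their
    union, and so obeys the bound on [mu]. *)
Let mu_sum (F : nat -> set B) (P : pred nat) k :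
  (forall i, measurable (F i)) -> (forall i, (i < k)%N -> F i `<=` Omega) ->
  trivIset `I_k F ->
  exists A, borel_in Omega A /\ mu A = \sum_(i < k | P i) mu (F i).
Proof.
move=> mF FO tF; exists (\big[setU/set0]_(i < k | P i) F i).
have mu0 : mu set0 = 0.
  by have := fa_set0 trace_content_add; rewrite /trace_content setI0.
elim: k FO tF => [|k IH] FO tF.
  rewrite !big_ord0; split => //; split; last exact: sub0set.
  exact: (@measurable0 _ B).
have tF' : trivIset `I_k F.
  by apply: sub_trivIset tF => i /= /ltnW; rewrite ltnS.
have [bI muI] := IH (fun i ik => FO i (ltnW ik)) tF'.
rewrite big_mkcond big_ord_recr/= -big_mkcond/=.
rewrite [X in _ /\ _ = X]big_mkcond big_ord_recr/= -big_mkcond/=.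
case: ifPn => Pk; last by rewrite setU0 addr0.
have Fk : borel_in Omega (F k) by split; [exact: mF|exact: FO].
split; last first.
  rewrite -muI; apply: (ba_additive mu_ba) => //.
  apply/seteqP; split => // x [+ Fkx].
  rewrite big_mkcond -(bigcup_mkord k (fun i => if P i then F i else set0)).
  move=> [i /= ik]; case: ifP => // _ Fix.
  have := tF i k (ltnW ik : `I_k.+1 i) (ltnSn k : `I_k.+1 k).
  by move=> /(_ (ex_intro _ x (conj Fix Fkx))) ik'; rewrite ik' ltnn in ik.
split; first by apply: (@measurableU _ B); [case: bI|exact: mF].
by rewrite subUset; split; [case: bI|exact: FO].
Qed.

(** The pieces of a partition split by the sign of [mu]; each group contributes at most the bound
    [M] of [mu], whence [M + M]. *)
Lemma ba_variation_bounded : exists M : R, forall A, borel_in Omega A ->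
  (ba_variation mu A <= M%:E)%E.
Proof.
have [M HM] := ba_bounded mu_ba; exists (M + M) => A [bA AO].
apply: ge_ereal_sup => _ [k [F [bF tF FA ->]]].
have FO i : (i < k)%N -> F i `<=` Omega.
  by move=> ik; apply: subset_trans AO; rewrite -FA; exact: bigcup_sup.
have [P [bP muP]] := mu_sum (fun i => 0 <= mu (F i)) bF FO tF.
have [N [bN muN]] := mu_sum (fun i => ~~ (0 <= mu (F i))) bF FO tF.
rewrite lee_fin (bigID (fun i : 'I_k => 0 <= mu (F i)))/=.
apply: lerD.
  rewrite (eq_bigr (fun i : 'I_k => mu (F i))) => [|i /ger0_norm//].
  by rewrite -muP; apply: le_trans (HM _ bP); exact: ler_norm.
rewrite (eq_bigr (fun i : 'I_k => - mu (F i))); last first.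
  by move=> i; rewrite -ltNge => /ltr0_norm.
by rewrite sumrN -muN; apply: le_trans (HM _ bN); rewrite -normrN ler_norm.
Qed.

Let var_ge k (F : nat -> set B) A : (forall i, measurable (F i)) ->
  trivIset `I_k F -> \bigcup_(i in `I_k) F i = A ->
  ((\sum_(i < k) `|mu (F i)|)%:E <= ba_variation mu A)%E.
Proof.
by move=> mF tF FA; apply: ereal_sup_ubound; exists k, F.
Qed.

Let norm_le_var A : borel A -> (`|mu A|%:E <= ba_variation mu A)%E.
Proof.
move=> bA; have := @var_ge 1 (fun=> A) A.
rewrite big_ord1; apply => //.
- by move=> i j /=; rewrite !ltnS !leqn0 => /eqP -> /eqP ->.
- by apply/seteqP; split => [x [i _]//|x Ax]; exists 0%N.
Qed.

Let var_fin A : borel_in Omega A -> ba_variation mu A \is a fin_num.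
Proof.
move=> bA; have [M HM] := ba_variation_bounded.
rewrite ge0_fin_numE; first exact: le_lt_trans (HM _ bA) (ltry _).
by apply: le_trans (norm_le_var bA.1); rewrite lee_fin.
Qed.

Lemma variation_contentE A : measurable A ->
  (variation_content A)%:E = ba_variation mu (Omega `&` A).
Proof. by move=> mA; rewrite /variation_content fineK//;
  exact/var_fin/borel_inI. Qed.

Lemma norm_trace_content_le A : measurable A ->
  `|trace_content A| <= variation_content A.
Proof.
move=> mA; rewrite -lee_fin variation_contentE//.
by apply: norm_le_var; exact: (borel_inI mA).1.
Qed.

Lemma variation_content_ge0 A : measurable A -> 0 <= variation_content A.
Proof. by move=> /norm_trace_content_le; exact: le_trans. Qed.

Let var_superadd A A' : borel_in Omega A -> borel_in Omega A' ->
  A `&` A' = set0 ->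
  (ba_variation mu A + ba_variation mu A' <= ba_variation mu (A `|` A'))%E.
Proof.
move=> bA bA' AA'.
rewrite -leeBrDr ?var_fin//; apply: ge_ereal_sup => _ [k [F [bF tF FA ->]]].
rewrite leeBrDr ?var_fin// addeC -leeBrDr//.
apply: ge_ereal_sup => _ [l [G [bG tG GA ->]]].
rewrite leeBrDr// -EFinD.
(* Concatenation of the partitions: the [k] pieces of [A], then the [l] pieces of [A']. *)
pose H i := if (i < k)%N then F i else G (i - k)%N.
have FG i j : (i < k)%N -> (j < l)%N -> F i `&` G j = set0.
  move=> ik jl; apply/seteqP; split => // x [Fx Gx]; rewrite -AA'; split.
    by rewrite -FA; exists i.
  by rewrite -GA; exists j.
have := @var_ge (k + l) H (A `|` A').
rewrite big_split_ord/= addrC.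
under eq_bigr => i _ do rewrite /H ltnNge leq_addr /= addKn.
under [X in _ + X]eq_bigr => i _ do rewrite /H ltn_ord.
apply.
- by move=> i; rewrite /H; case: ifP => _; [exact: bF|exact: bG].
- move=> i j /= ikl jkl; rewrite /H; case: ltnP => ik; case: ltnP => jk.
  + exact: tF.
  + by rewrite FG ?ltn_subLR// => -[].
  + by rewrite setIC FG ?ltn_subLR// => -[].
  + move=> /tG; rewrite /= !ltn_subLR// => /(_ ikl jkl) ij.
    by rewrite -(subnKC ik) -(subnKC jk) ij.
- apply/seteqP; split => x.
    move=> [i /= ikl]; rewrite /H; case: ltnP => ik Hx.
      by left; rewrite -FA; exists i.
    by right; rewrite -GA; exists (i - k)%N => //=; rewrite ltn_subLR.
  move=> [|]; rewrite -?FA -?GA => -[i /= il Hx].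
    by exists i; [exact: ltn_addr|rewrite /H il].
  exists (k + i)%N; first by rewrite /= ltn_add2l.
  by rewrite /H ltnNge leq_addr /= addKn.
Qed.

(** Intersecting a partition of the union with [A] and with [A'] gives partitions of both;
    additivity of [mu] and the triangle inequality compare the sums. *)
Let var_subadd A A' : borel_in Omega A -> borel_in Omega A' ->
  A `&` A' = set0 ->
  (ba_variation mu (A `|` A') <= ba_variation mu A + ba_variation mu A')%E.
Proof.
move=> bA bA' AA'; apply: ge_ereal_sup => _ [k [F [bF tF FA ->]]].
have FE i : (i < k)%N -> F i = (F i `&` A) `|` (F i `&` A').
  move=> ik; rewrite -setIUr setIidl// -FA; exact: bigcup_sup.
have part C : C = A \/ C = A' ->
    ((\sum_(i < k) `|mu (F i `&` C)|)%:E <= ba_variation mu C)%E.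
  move=> CA; have bC : borel_in Omega C by case: CA => ->.
  apply: (@var_ge k (fun i => F i `&` C)).
  - by move=> i; apply: (@measurableI _ B); [exact: bF|case: bC].
  - exact: trivIset_setIr.
  - rewrite -setI_bigcupl FA; apply/setIidr.
    by case: CA => ->; [exact: subsetUl|exact: subsetUr].
apply: le_trans (leeD (part A (or_introl erefl)) (part A' (or_intror erefl))).
rewrite -EFinD lee_fin -big_split/=; apply: ler_sum => i _.
have bFC C : borel_in Omega C -> borel_in Omega (F i `&` C).
  move=> [bC CO]; split; first by apply: (@measurableI _ B) => //; exact: bF.
  by move=> x [_ /CO].
rewrite [in leLHS]FE// (ba_additive mu_ba); first exact: ler_normD.
- exact: bFC.
- exact: bFC.
- by rewrite setIACA AA' setI0.
Qed.

Lemma variation_content_add : finitely_additive variation_content.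
Proof.
move=> A A' mA mA' AA'; apply: EFin_inj.
rewrite EFinD !variation_contentE//; last exact: (@measurableU _ B).
rewrite setIUr; apply/eqP; rewrite eq_le.
by rewrite var_superadd ?var_subadd//; do ?exact: borel_inI;
  rewrite setIACA AA' setI0.
Qed.

End variation.

(** * Comparison of the integrals of a continuous function *)

(** The sum is [e] times the number of multiples [e, 2e, ..., Ne] not exceeding [y], that is, [y]
    rounded down to a multiple of [e]. *)
Lemma floor_sum_bounds (R : realType) (e y : R) (N : nat) :
  0 <= e -> 0 <= y -> y < e *+ N ->
  y - e <= \sum_(i < N) e * (e *+ i.+1 <= y)%R%:R <= y.
Proof.
move=> e0 y0 yN.
suff H k : (e *+ k <= y -> \sum_(i < k) e * (e *+ i.+1 <= y)%R%:R = e *+ k) /\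
    (y < e *+ k -> y - e <= \sum_(i < k) e * (e *+ i.+1 <= y)%R%:R <= y).
  exact: (H N).2.
elim: k => [|k [IH1 IH2]].
  by rewrite mulr0n big_ord0; split => // /(le_lt_trans y0); rewrite ltxx.
rewrite big_ord_recr/=; split => [ky|yk].
  by rewrite IH1 ?ky ?mulr1 ?mulrSr// (le_trans _ ky)// mulrSr lerDl.
rewrite [e *+ k.+1 <= y]leNgt yk mulr0 addr0.
have [ky|ky] := leP (e *+ k) y; last exact: IH2.
by rewrite IH1// ky andbT lerBlDr -mulrSr ltW.
Qed.

Lemma within_continuous_closed (T : topologicalType) (R : realType)
    (X : set T) (f : T -> R) (F : set R) :
  closed X -> {within X, continuous f} -> closed F -> closed (X `&` f @^-1` F).
Proof.
move=> cX /continuous_closedP cf cF.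
have /closed_subspaceP[V cV VE] := cf _ cF.
by rewrite setIC -VE; exact: closedI.
Qed.

Lemma within_continuous_measurable (T : ptopologicalType) (R : realType)
    (X : set T) (f : T -> R) :
  closed X -> {within X, continuous f} ->
  measurable_fun (X : set (borelType T)) f.
Proof.
move=> cX cf.
apply: (measurability (@measurable_realfun.RGenCInfty.G R)) => [|/= _ [_] [r]
  -> <-].
  exact: measurable_realfun.RGenCInfty.measurableE.
apply: closed_borel; apply: within_continuous_closed => //.
exact: interval_closed.
Qed.

Section integral_of_simple.
Context d (T : measurableType d) (R : realType).
Variable lam : {finite_measure set T -> \bar R}.

Lemma fine_measure_add : finitely_additive (fun A => fine (lam A)).
Proof.
move=> A B mA mB AB; rewrite measureU// fineD//; exact: fin_num_measure.
Qed.

Variable D : set T.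
Hypothesis mD : measurable D.

Lemma simple_integrable (s : T -> R) :
  simple s -> lam.-integrable D (EFin \o s).
Proof.
move=> ss; apply: measurable_bounded_integrable => //.
- by rewrite -ge0_fin_numE//; exact: fin_num_measure.
- by move=> _ Y mY; apply: measurableI => //; exact: simple_preimage.
have [s' <-] := simple_sfun ss.
have [M [_ HM]] := simple_bounded s'.
by exists M; split; rewrite ?num_real// => x Mx z _; exact: HM.
Qed.

Lemma integral_simple (s : T -> R) : simple s -> lam (~` D) = 0%E ->
  (\int[lam]_(x in D) (s x)%:E = (sint (fun A => fine (lam A)) s)%:E)%E.
Proof.
move=> ss lamD; have [r [ur sr]] := simple_range_seq ss.
rewrite (sint_comp fine_measure_add id ss ur sr).
have sE x : (s x)%:E = (\sum_(y <- r) y%:E * (\1_(s @^-1` [set y]) x)%:E)%E.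
  rewrite (bigD1_seq (s x))//= indicE mem_set// mule1 big1 ?adde0// => y ysx.
  rewrite indicE memNset ?mule0// => syx.
  by move: ysx; rewrite -syx eqxx.
under eq_integral do rewrite sE.
have ind y : lam.-integrable D (fun x => (\1_(s @^-1` [set y]) x)%:E).
  by apply: simple_integrable; apply: simple_indic; exact: ss.2.
rewrite integral_sum//; last by move=> y; exact: integrableZl.
rewrite -sumEFin; apply: eq_bigr => y _.
rewrite integralZl// integral_indic//; last exact: ss.2.
rewrite EFinM; congr (_ * _)%E; rewrite fineK; last exact/fin_num_measure/ss.2.
have my := ss.2 y.
rewrite [RHS](measureDI lam my mD).
rewrite [X in _ = (X + _)%E](_ : _ = 0%E) ?add0e//.
apply/eqP; rewrite eq_le measure_ge0 andbT -lamD.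
apply: le_measure; rewrite ?inE//.
- exact: measurableD.
- exact: measurableC.
Qed.

Lemma integral_near_simple (f s : T -> R) (e : R) : simple s ->
  lam (~` D) = 0%E -> lam.-integrable D (EFin \o f) -> 0 <= e ->
  (forall x, D x -> `|s x - f x| <= e) ->
  `|sint (fun A => fine (lam A)) s - fine (\int[lam]_(x in D) (f x)%:E)| <=
  e * fine (lam setT).
Proof.
move=> ss lamD intf e0 sf.
have ints := simple_integrable ss.
have finD : lam D \is a fin_num by exact: fin_num_measure.
have finf : (\int[lam]_(x in D) (f x)%:E)%E \is a fin_num.
  exact: integrable_fin_num.
rewrite -lee_fin -abse_EFin EFinB -integral_simple// fineK// -integralB_EFin//.
have msf := measurable_int _ (integrableB mD ints intf).
apply: le_trans (le_abse_integral _ mD msf) _.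
apply: (@le_trans _ _ (e%:E * lam D)%E).
  apply: integral_le_bound => //.
  by apply: aeW => x Dx; rewrite -EFinB abse_EFin lee_fin sf.
rewrite EFinM fineK ?fin_num_measure//; apply: lee_wpmul2l;
  first by rewrite lee_fin.
by apply: le_measure; rewrite ?inE.
Qed.

End integral_of_simple.

(* The approximant is the layer sum of e * 1_{f >= i e - M}, which reduces the
   comparison of the two integrals to the interlacing of the contents and the
   measures of the level sets. *)
Section uniform_approximation.
Context (T : ptopologicalType) (R : realType).
Hypothesis hT : hausdorff_space T.
Local Notation B := (borelType T).
Variables (X : set T) (f : T -> R).
Hypotheses (cX : compact X) (cf : {within X, continuous f}).

Let clX : closed X. Proof. exact: compact_closed. Qed.

Lemma uniform_simple_approximation (e : R) : 0 < e -> exists s : B -> R,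
  [/\ simple s, forall x, X x -> `|s x - f x| <= e &
   forall (nu : set B -> R) (lam : {finite_measure set B -> \bar R}),
    finitely_additive nu -> (forall A, measurable A -> 0 <= nu A) ->
    nu (~` X) = 0 ->
    (forall K : set T, compact K -> ((nu K)%:E <= lam K)%E) ->
    (forall U : set T, open U -> (lam U <= (nu U)%:E)%E) ->
    `|sint nu s - sint (fun A => fine (lam A)) s| <= e * nu setT].
Proof.
move=> e0.
have [M HM] : exists M : R, forall x, X x -> `|f x| <= M.
  have [M [_ HM]] := compact_bounded (continuous_compact cf cX).
  exists (M + 1) => x Xx; apply: (HM (M + 1)); first by rewrite ltrDl.
  by exists x.
have [N HN] : exists N : nat, M + M < e *+ N.
  exists (Num.truncn ((M + M) / e)).+1.
  by rewrite -mulr_natl -ltr_pdivrMr// truncnS_gt.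
pose A i : set T := X `&` f @^-1` [set y | e *+ i - M <= y].
have cA i : compact (A i).
  apply: subclosed_compact cX _; last exact: subIsetl.
  exact: (within_continuous_closed clX cf (@closed_ge _ _)).
have mA i : measurable (A i : set B) by exact: compact_borel.
have mX : measurable (X : set B) by exact: closed_borel.
have sA i : simple (fun x : B => e * \1_(A i) x).
  by apply: (simple_comp (fun y => e * y)); exact: simple_indic.
pose s (x : B) : R := \sum_(i < N) e * \1_(A i.+1) x - M.
have s0A : simple (fun x : B => \sum_(i < N) e * \1_(A i.+1) x).
  exact: simple_sum.
have ss : simple s by exact: (simple_comp (fun y => y - M)).
have sE (m : set B -> R) : finitely_additive m ->
    sint m s = \sum_(i < N) e * m (A i.+1) - M * m setT.
  move=> m_add; rewrite (sintB m_add s0A (simple_cst _ M)) (sint_cst m_add).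
  congr (_ - _); rewrite (sint_sum m_add)//; apply: eq_bigr => i _.
  by rewrite (sintZ m_add) ?(sint_indic m_add)//; exact: simple_indic.
(* [s] is built from [f] alone, before [nu] and [lam] are given, so that one approximant can serve
   several contents simultaneously. *)
exists s; split => //.
- move=> x Xx; have := HM x Xx; rewrite ler_norml => /andP[fM1 fM2].
  have y0 : 0 <= f x + M by lra.
  have yN : f x + M < e *+ N by lra.
  have := floor_sum_bounds (ltW e0) y0 yN.
  have -> : \sum_(i < N) e * (e *+ i.+1 <= f x + M)%R%:R = s x + M.
    rewrite /s subrK; apply: eq_bigr => i _; congr (_ * _).
    rewrite indicE; congr (nat_of_bool _)%:R.
    by apply/idP/idP; rewrite inE /A /preimage/= lerBlDr; [move=> ?;
      split|case].
  by move=> /andP[l1 l2]; rewrite ler_norml; apply/andP; split; lra.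
- move=> nu lam nu_add nu_ge0 nuX nulam lamnu.
  have lam_add := fine_measure_add lam.
  rewrite !sE//.
  pose l C := fine (lam C).
  have lE C : measurable C -> (l C)%:E = lam C.
    by move=> mC; rewrite /l fineK// fin_num_measure.
  have nul K : compact K -> nu K <= l K.
    by move=> cK; rewrite -lee_fin lE ?nulam//; exact: compact_borel.
  have lnu U : open U -> l U <= nu U.
    by move=> oU; rewrite -lee_fin lE ?lamnu//; exact: open_borel.
  have l_ge0 C : measurable C -> 0 <= l C by move=> _; exact: fine_ge0.
  have nuT : nu setT = nu X.
    by rewrite (fa_setDI nu_add measurableT mX) setTD nuX add0r setTI.
  (* Equality of the total masses, by [nu X <= lam X <= lam setT <= nu setT = nu X], lets the terms
     with [M] cancel. *)
  have -> : fine (lam setT) = nu setT.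
    apply/eqP; rewrite eq_le (lnu _ openT) nuT (le_trans (nul _ cX))//.
    exact: (fa_le lam_add l_ge0).
  have cancel (a b c : R) : a - c - (b - c) = a - b by lra.
  rewrite cancel -sumrB.
  rewrite (eq_bigr (fun i : 'I_N => - (e * (l (A i.+1) - nu (A i.+1)))));
    last first.
    by move=> i _; rewrite -mulrBr -mulrN opprB.
  rewrite sumrN normrN -mulr_sumr normrM (gtr0_norm e0) ler_wpM2l ?(ltW e0)//.
  rewrite ger0_norm; last by apply: sumr_ge0 => i _; rewrite subr_ge0 nul.
  apply: (@le_trans _ _ (\sum_(0 <= i < N) (nu (A i) - nu (A i.+1)))).
    rewrite big_mkord; apply: ler_sum => i _; rewrite lerB//.
    (* The set where [f > e *+ i - M] is open only relative to [X]. Adding the complement of [X]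
       makes it open in [T] at no cost, since that complement is [nu]-null. *)
    pose W := ~` (X `&` f @^-1` [set y | y <= e *+ i - M]).
    have oW : open W.
      by rewrite openC; exact:
        (within_continuous_closed clX cf (@closed_le _ _)).
    have mW : measurable (W : set B) by exact: open_borel.
    apply: (@le_trans _ _ (l W)).
      apply: (fa_le lam_add l_ge0) => // x [Xx];
        rewrite /preimage/= => fx [_] /=.
      apply/negP; rewrite -ltNge; apply: lt_le_trans fx.
      by rewrite ltrD2r mulrS ltrDr.
    apply: le_trans (lnu _ oW) _.
    rewrite (fa_setDI nu_add mW mX) [X in X + _](_ : _ = 0) ?add0r.
      apply: (fa_le nu_add nu_ge0) => //; first exact: measurableI.
      move=> x [nW Xx]; split => //=;
        have [//|/ltW fx] := leP (e *+ i - M) (f x).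
      by exfalso; apply: nW.
    apply/eqP; rewrite eq_le nu_ge0 ?andbT; last exact: measurableD.
    rewrite -nuX; apply: (fa_le nu_add nu_ge0) => //.
    - exact: measurableD.
    - exact: measurableC.
  rewrite (eq_bigr (fun i => - nu (A i.+1) - - nu (A i))); last first.
    by move=> i _; rewrite opprK addrC.
  rewrite (telescope_sumr (fun i => - nu (A i)))// opprK addrC lerBlDr.
  apply: (@le_trans _ _ (nu setT)); first exact: (fa_le nu_add nu_ge0).
  by rewrite lerDl nu_ge0.
Qed.

End uniform_approximation.

(** * Values of the finitely additive integral *)

Lemma sintegral_simple d (T : measurableType d) (R : realType)
    (nu : set T -> \bar R) (m : set T -> R) (s : T -> R) :
  finitely_additive m -> (forall A, measurable A -> nu A = (m A)%:E) ->
  simple s -> sintegral nu s = (sint m s)%:E.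
Proof.
move=> m_add num ss; have [r [ur sr]] := simple_range_seq ss.
rewrite (sint_comp m_add id ss ur sr) /sintegral.
rewrite -(@fsbig_widen _ _ _ _ [set` r])//; last first.
  move=> x [_ /= xr]; rewrite (_ : _ @^-1` _ = set0).
    by rewrite num// (fa_set0 m_add) mule0.
  by apply/seteqP; split => // t /= st; apply: xr; rewrite -st.
rewrite -fsbig_seq// -sumEFin; apply: eq_bigr => y _.
by rewrite num ?EFinM//; exact: ss.2.
Qed.

Section ba_integral_characterisation.
Context (R : realType) (n : nat).
Variables (Omega : set 'rV[R]_n) (mu : set 'rV[R]_n -> R).
Hypotheses (bO : borel Omega) (mu_ba : ba Omega mu).
Local Notation B := (borelRn R n).
Local Notation m := (trace_content Omega mu).
Local Notation v := (variation_content Omega mu).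

Let m_add : finitely_additive m. Proof. exact: trace_content_add. Qed.
Let v_add : finitely_additive v. Proof. exact: variation_content_add. Qed.
Let v_ge0 A : measurable A -> 0 <= v A.
Proof. exact: variation_content_ge0. Qed.

Let v_setC : v (~` Omega) = 0.
Proof.
by have := fa_set0 v_add; rewrite /variation_content setI0 setICr.
Qed.

Let simple_integral_var (s : B -> R) : simple s ->
  simple_integral Omega (ba_variation mu) s = (sint v s)%:E.
Proof.
move=> ss; apply: sintegral_simple => // A mA.
by rewrite variation_contentE.
Qed.

Let simple_integral_mu (s : B -> R) : simple s ->
  simple_integral Omega (fun A => (mu A)%:E) s = (sint m s)%:E.
Proof. by move=> ss; exact: sintegral_simple. Qed.

Import HBSimple.

Let sintv_norm_bound (s t : B -> R) (c : R) : simple s -> simple t ->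
  (forall x, Omega x -> `|s x - t x| <= c) ->
  sint v (fun x => `|s x - t x|) <= c * v setT.
Proof.
move=> ss st H; rewrite -(sint_cst v_add);
  apply: (le_sint v_add v_ge0 bO v_setC).
- exact: (simple_comp2 (fun x y => `|x - y|)).
- exact: simple_cst.
- by [].
Qed.

(* Let [s_k] define the integral of [f] and [A] be a set of small variation
   containing the points where [s_k] is far from [f]. There, [`|s_k - t|] is at
   most [`|s_k - s_N| + C] with [C] independent of [k], whose integral over
     [A] is
   small by the Cauchy property. *)
Lemma is_ba_integral_near_simple (f t : 'rV[R]_n -> R) (I e : R) :
  is_ba_integral Omega mu f I -> simple (t : B -> R) -> 0 < e ->
  (forall x, Omega x -> `|t x - f x| <= e) ->
  `|I - sint m t| <= 2 * e * v setT.
Proof.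
move=> [s [s_meas s_cauchy s_lim]] st e0 tf.
have ss k : simple (s k) by exact: sfun_simple.
apply/ler_addgt0Pr => a a0.
have a30 : 0 < a / 3 by rewrite divr_gt0.
have [[P Q] [[N1 _ HP] [N2 _ HQ]] Hs] := s_cauchy _ a30.
pose N := maxn N1 N2.
have [C C0 HC] : exists2 C : R, 0 < C & forall x, `|s N x - t x| <= C.
  have [t' t'E] := simple_sfun st.
  have [M [_ HM]] := simple_bounded (s N - t').
  exists (`|M| + 1); first by rewrite ltr_wpDl.
  move=> x; have := HM (`|M| + 1) _ x Logic.I.
  rewrite -t'E; apply; by rewrite (le_lt_trans (ler_norm _))// ltrDl.
(* The tolerance [a] is shared equally by the limit, the Cauchy term and [C * v A]. *)
have aC : 0 < a / 3 / C by rewrite divr_gt0.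
have near1 : \forall k \near \oo, (outer_variation Omega mu
    [set x | Omega x /\ (e < `|s k x - f x|)%R] < (a / 3 / C)%:E)%E.
  have aC' : (0%:E < (a / 3 / C)%:E)%E by rewrite lte_fin.
  exact: (s_meas e e0 _ (open_ereal_lt' aC')).
have near2 : \forall k \near \oo, `|I - sint m (s k)| < a / 3.
  have /fine_cvg/cvgrPdist_lt/(_ _ a30) := s_lim.
  by apply: filterS => k /=; rewrite simple_integral_mu.
near \oo => k.
have kN : (N <= k)%N by near: k; exists N.
have : (outer_variation Omega mu
    [set x | Omega x /\ (e < `|s k x - f x|)%R] < (a / 3 / C)%:E)%E by near: k.
move=> /ereal_inf_lt[_ [A [[bA AO] sA] <-]].
have -> : A = Omega `&` A by apply/esym/setIidr.
rewrite -variation_contentE// lte_fin => vA.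
have I_sk : `|I - sint m (s k)| < a / 3 by near: k.
have skN : sint v (fun x => `|s k x - s N x|) < a / 3.
  rewrite -lte_fin -simple_integral_var; last first.
    exact: (simple_comp2 (fun x y => `|x - y|)).
  apply: (Hs (k, N)); split; [apply: HP|apply: HQ] => /=.
    by rewrite (leq_trans _ kN)// leq_maxl.
  by rewrite leq_maxr.
have sk_t : `|sint m (s k) - sint m t| <= a / 3 + a / 3 + 2 * e * v setT.
  rewrite -(sintB m_add (ss k) st).
  have sD : simple (fun x : B => `|s k x - s N x|).
    exact: (simple_comp2 (fun x y => `|x - y|)).
  have sCA : simple (fun x : B => C * \1_A x).
    by apply: (simple_comp (fun y => C * y)); exact: simple_indic.
  apply: le_trans (sint_norm_le m_add v_add _ _) _.
  - by move=> D mD; exact: norm_trace_content_le.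
  - exact: (simple_comp2 (fun x y => x - y)).
  (* Off [A], both [s k] and [t] are within [e] of [f]; this accounts for the constant [2 * e]. *)
  apply: (@le_trans _ _ (sint v (fun x => `|s k x - s N x| + C * \1_A x + 2 *
    e))).
    apply: (le_sint v_add v_ge0 bO v_setC).
    - exact: (simple_comp2 (fun x y => `|x - y|)).
    - apply: (simple_comp (fun y => y + 2 * e)).
      exact: (simple_comp2 (fun x y => x + y)).
    - move=> x Ox; have [Ax|nAx] := pselect (A x).
        rewrite indicE mem_set// mulr1.
        have := ler_distD (s N x) (s k x) (t x); have := HC x; lra.
      rewrite indicE memNset// mulr0 addr0.
      have : `|s k x - f x| <= e.
        by rewrite leNgt; apply/negP => skf; apply: nAx; exact: sA.
      have := ler_distD (f x) (s k x) (t x); have := tf x Ox.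
      rewrite (distrC (f x)); have := normr_ge0 (s k x - s N x); lra.
  rewrite (sintD v_add (f := fun x => `|s k x - s N x| + C * \1_A x));
    last first.
  - exact: simple_cst.
  - exact: (simple_comp2 (fun x y => x + y)).
  rewrite (sintD v_add sD sCA) (sint_cst v_add) lerD2r.
  rewrite lerD ?(ltW skN)// (sintZ v_add)//; last exact: simple_indic.
  rewrite (sint_indic v_add)// mulrC -ler_pdivlMr// ltW//.
have := ler_distD (sint m (s k)) I (sint m t); lra.
Unshelve. all: by end_near. Qed.

(** [ba_integral] selects by [get], so two things are shown: [J] is an admissible value, by simple
    functions with uniform error [1 / (k + 1)], and the selected value is arbitrarily close to
    [J]. *)
Lemma ba_integral_eq (f : 'rV[R]_n -> R) (J : R) :
  (forall e : R, 0 < e -> exists s : B -> R,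
    [/\ simple s, forall x, Omega x -> `|s x - f x| <= e &
        `|sint m s - J| <= e]) ->
  ba_integral Omega mu f = J.
Proof.
move=> H.
have exJ : is_ba_integral Omega mu f J.
  have inv k : 0 < k.+1%:R^-1 :> R by rewrite invr_gt0.
  have /choice[s0 Hs0] k := H _ (inv k).
  have /choice[s Hs] k : exists s : {sfun B >-> R}, s = s0 k :> (B -> R).
    by apply: simple_sfun; have [] := Hs0 k.
  have ss k : simple (s k) by exact: sfun_simple.
  have sf k x : Omega x -> `|s k x - f x| <= k.+1%:R^-1.
    by rewrite Hs; have [_ + _] := Hs0 k; apply.
  have sJ k : `|sint m (s k) - J| <= k.+1%:R^-1.
    by rewrite Hs; have [] := Hs0 k.
  have lim_inv e : 0 < e -> \forall k \near \oo, k.+1%:R^-1 < e :> R.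
    by move=> e0; exact: (near_infty_natSinv_lt (PosNum e0)).
  exists s; split.
  - move=> e e0; apply: cvg_near_cst.
    near=> k.
    have -> : [set x | Omega x /\ e < `|s k x - f x|] = set0.
      apply/seteqP; split => // x [Ox]; rewrite ltNge => /negP; apply.
      by apply: le_trans (sf k x Ox) _; apply: ltW; near: k; exact: lim_inv.
    have var0 : ba_variation mu set0 = 0%E.
      by rewrite -(setI0 Omega) -variation_contentE// (fa_set0 v_add).
    apply/eqP; rewrite eq_le; apply/andP; split.
      apply: ereal_inf_lbound; exists set0 => //; split => //.
      by split => //; exact: (@measurable0 _ B).
    apply: le_ereal_inf_tmp => _ [A [[bA AO] _] <-].
    rewrite -(setIidr AO) -variation_contentE// lee_fin; exact: v_ge0.
  - move=> e e0.
    (* The summand 1 keeps the denominator positive when [v setT = 0] and makes the final inequality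
       strict. *)
    have d0 : 0 < 2 * v setT + 1 by rewrite ltr_wpDl// mulr_ge0// v_ge0.
    pose d := e / (2 * v setT + 1).
    have e_d : e = d * (2 * v setT + 1) by rewrite divfK ?gt_eqF.
    have dd0 : 0 < d by rewrite divr_gt0.
    near=> k l.
    have kd : k.+1%:R^-1 < d by near: k; exact: lim_inv.
    have ld : l.+1%:R^-1 < d by near: l; exact: lim_inv.
    rewrite simple_integral_var;
      last exact: (simple_comp2 (fun x y => `|x - y|)).
    rewrite lte_fin; apply: le_lt_trans (sintv_norm_bound (c := d + d) _ _ _) _.
    - exact: ss.
    - exact: ss.
    - move=> x Ox; apply: le_trans (ler_distD (f x) _ _) _.
      by rewrite [`|f x - _|]distrC lerD// (le_trans (sf _ x Ox))// ltW.
    - by rewrite [ltRHS]e_d mulrDr mulr1 mulrA [d * 2]mulr_natr mulr2n ltrDl.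
  - under eq_fun do rewrite simple_integral_mu//.
    apply: cvg_EFin; first exact: nearW.
    apply/cvgrPdist_lt => e e0; near=> k.
    rewrite distrC; apply: le_lt_trans (sJ k) _.
    by near: k; exact: lim_inv.
have int := getPex (ex_intro _ J exJ).
apply/eqP; rewrite -subr_eq0 -normr_le0; apply/ler_addgt0Pr => a a0.
rewrite add0r.
(* The tolerance used below solves [2 * x * v setT + x = a], the sum of the two errors. *)
have d0 : 0 < 2 * v setT + 1 by rewrite ltr_wpDl// mulr_ge0// v_ge0.
have [s [ss sf sJ]] := H _ (divr_gt0 a0 d0).
have Is := is_ba_integral_near_simple int ss (divr_gt0 a0 d0) sf.
apply: le_trans (ler_distD (sint m s) _ _) _.
apply: le_trans (lerD Is sJ) _.
rewrite le_eqVlt; apply/orP; left; apply/eqP; field.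
by rewrite gt_eqF.
Unshelve. all: by end_near. Qed.

End ba_integral_characterisation.

(** * Differences of finite measures *)

Lemma sint_subr d (T : measurableType d) (R : realType) (m1 m2 : set T -> R)
    (s : T -> R) : finitely_additive m1 -> finitely_additive m2 -> simple s ->
  sint (fun A => m1 A - m2 A) s = sint m1 s - sint m2 s.
Proof.
move=> m1_add m2_add ss; have [r [ur sr]] := simple_range_seq ss.
rewrite (sint_comp m1_add id ss ur sr) (sint_comp m2_add id ss ur sr).
rewrite (sint_comp _ id ss ur sr); last first.
  by move=> A B mA mB AB; rewrite m1_add// m2_add//; ring.
by rewrite -sumrB; apply: eq_bigr => y _; rewrite mulrBr.
Qed.

Section charge_difference.
Context d (T : measurableType d) (R : realType).
Variables lam1 lam2 : {finite_measure set T -> \bar R}.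
Local Open Scope ereal_scope.

Lemma charge_difference : exists sigma : {charge set T -> \bar R},
  forall A, measurable A -> sigma A = lam1 A - lam2 A.
Proof.
by exists (cadd (charge_of_finite_measure lam1)
  (copp (charge_of_finite_measure lam2))).
Qed.

Variable sigma : {charge set T -> \bar R}.
Hypothesis sigmaE : forall A, measurable A -> sigma A = lam1 A - lam2 A.

Let jordan_sub A : measurable A ->
  sigma A = jordan_pos (hahn sigma) A - jordan_neg (hahn sigma) A.
Proof. by move=> mA; rewrite (jordan_decomp (hahn sigma) mA) /cadd /=
  cscaleN1. Qed.

(** On the positive Hahn set [sigma] is at most [lam1], on the negative one [- sigma] is at most
    [lam2]; an overlap of [lam1] and [lam2] only makes the bound larger. *)
Lemma signed_variation_le A : measurable A ->
  signed_variation sigma A <= lam1 A + lam2 A.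
Proof.
move=> mA; rewrite /signed_variation /charge_variation.
have [[mP _] [mN _] _ _] := hahn sigma.
apply: leeD.
  rewrite jordan_posE cjordan_posE /crestr0 mem_set// /crestr sigmaE;
    last first.
    exact: measurableI.
  apply: (@le_trans _ _ (lam1 (A `&` (projT1 (cid (hahn_exists sigma))).1))).
    by rewrite leeBlDr ?fin_num_measure//; [rewrite leeDl|exact: measurableI].
  by apply: le_measure; rewrite ?inE//; exact: measurableI.
rewrite jordan_negE cjordan_negE /crestr0 mem_set// /crestr sigmaE; last first.
  exact: measurableI.
rewrite fin_num_oppeB ?fin_num_measure//; do ?exact: measurableI.
apply: (@le_trans _ _ (lam2 (A `&` (projT1 (cid (hahn_exists sigma))).2))).
  by rewrite addeC leeBlDr ?fin_num_measure//;
    [rewrite leeDl|exact: measurableI].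
by apply: le_measure; rewrite ?inE//; exact: measurableI.
Qed.

(** The Jordan parts of [sigma] may differ from [lam1] and [lam2], which need not be mutually
    singular. But the positive part plus [lam2] is the same measure as [lam1] plus the negative
    part, and all integrals are finite, so terms can be moved across. *)
Lemma charge_integral_difference D (f : T -> R) : measurable D ->
  measurable_fun D f -> [bounded f x | x in D] ->
  charge_integral sigma D f =
  \int[lam1]_(x in D) (f x)%:E - \int[lam2]_(x in D) (f x)%:E.
Proof.
move=> mD mf bf; rewrite /charge_integral.
set jp := jordan_pos _; set jn := jordan_neg _.
have intf (nu : {finite_measure set T -> \bar R}) :
  nu.-integrable D (EFin \o f).
  apply: measurable_bounded_integrable => //.
  by rewrite -ge0_fin_numE//; exact: fin_num_measure.
have fin (nu : {finite_measure set T -> \bar R}) :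
    \int[nu]_(x in D) (f x)%:E \is a fin_num.
  by apply: integrable_fin_num => //; exact: intf.
have E : \int[jp]_(x in D) (f x)%:E + \int[lam2]_(x in D) (f x)%:E =
    \int[lam1]_(x in D) (f x)%:E + \int[jn]_(x in D) (f x)%:E.
  rewrite -!integral_measure_add//; do ?exact: intf.
  apply: eq_measure_integral => A mA _.
  transitivity (jp A + lam2 A); first exact: measure_addE.
  transitivity (lam1 A + jn A); last exact/esym/measure_addE.
  have := jordan_sub mA; rewrite sigmaE// -/jp -/jn.
  have : jp A \is a fin_num by exact: fin_num_measure.
  have : jn A \is a fin_num by exact: fin_num_measure.
  have : lam1 A \is a fin_num by exact: fin_num_measure.
  have : lam2 A \is a fin_num by exact: fin_num_measure.
  move: (jp A) (jn A) (lam1 A) (lam2 A).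
  move=> [a| |] [b| |] [c| |] [e| |]// _ _ _ _.
  by rewrite -!EFinB -!EFinD => -[?]; congr EFin; lra.
move: E (fin lam1) (fin lam2) (fin jp) (fin jn).
move: (\int[jp]_(_ in _) _) (\int[jn]_(_ in _) _).
move: (\int[lam1]_(_ in _) _) (\int[lam2]_(_ in _) _).
move=> [a| |] [b| |] [c| |] [e| |]// + _ _ _ _.
by rewrite -!EFinB -!EFinD => -[?]; congr EFin; lra.
Qed.

End charge_difference.

(** Outer approximation of the complement of [A] by an open [W] gives inner approximation of [A]:
    [X] minus [W] is compact, and what it misses of [U] lies in [U] minus [A], in the part of [W]
    inside [A], or outside [X]. *)
Lemma finite_measure_regular (T : ptopologicalType) (R : realType)
    (lam : {finite_measure set (borelType T) -> \bar R}) (X : set T) :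
  hausdorff_space T -> compact X -> lam (~` X) = 0%E ->
  (forall (A : set T) (e : R), measurable (A : set (borelType T)) -> 0 < e ->
    exists U : set T, [/\ open U, A `<=` U & (lam U <= lam A + e%:E)%E]) ->
  forall (A : set T) (e : R), measurable (A : set (borelType T)) -> 0 < e ->
    exists K U : set T, [/\ compact K, open U, K `<=` A, A `<=` U &
      (lam (U `\` K) <= e%:E)%E].
Proof.
move=> hT cX lamX reg A e mA e0.
have mX : measurable (X : set (borelType T)) by exact: compact_borel.
have mAC : measurable (~` A : set (borelType T)) by exact: measurableC.
have e20 : 0 < e / 2 by rewrite divr_gt0.
have [U [oU AU lamU]] := reg _ _ mA e20.
have [W [oW AW lamW]] := reg _ _ mAC e20.
have mU : measurable (U : set (borelType T)) by exact: open_borel.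
have mW : measurable (W : set (borelType T)) by exact: open_borel.
have clX : closed X by exact: compact_closed.
have diff (C D : set (borelType T)) : measurable C -> measurable D ->
    C `<=` D -> (lam D <= lam C + (e / 2)%:E -> lam (D `\` C) <= (e / 2)%:E)%E.
  move=> mC mD CD; rewrite measureD//; last first.
    by rewrite -ge0_fin_numE//; exact: fin_num_measure.
  by rewrite setIidr// leeBlDl// fin_num_measure.
exists (X `\` W), U; split => //.
- apply: subclosed_compact cX _; last exact: subDsetl.
  by rewrite setDE; apply: closedI => //; rewrite closedC.
- by move=> x [_ nWx]; apply: contrapT => nAx; apply: nWx; exact: AW.
have mUA : measurable (U `\` A : set (borelType T)) by exact: measurableD.
have mWA : measurable (W `\` ~` A : set (borelType T)) by exact: measurableD.
have mXC : measurable (~` X : set (borelType T)) by exact: measurableC.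
apply: (@le_trans _ _ (lam ((U `\` A) `|` (W `\` ~` A) `|` ~` X))).
  apply: le_measure; rewrite ?inE.
  - by apply: measurableD => //; exact: measurableD.
  - by apply: measurableU => //; exact: measurableU.
  - move=> x [Ux nXWx].
    have [Xx|] := pselect (X x); last by right.
    left; have [Ax|] := pselect (A x); last by left.
    right; split; last by apply.
    by apply: contrapT => nWx; exact: nXWx.
have mUW := measurableU _ _ mUA mWA.
apply: le_trans (measureU2 lam mUW mXC) _.
rewrite [X in (_ + X <= _)%E]lamX adde0.
apply: le_trans (measureU2 lam mUA mWA) _.
by rewrite [e in leRHS]splitr EFinD; apply: leeD; apply: diff.
Qed.

(** * The core and the null sets around it *)

Section core.
Context (R : realType) (n : nat).
Variables (Omega : set 'rV[R]_n) (mu : set 'rV[R]_n -> R).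
Hypotheses (bO : borel Omega) (mu_ba : ba Omega mu).
Local Notation B := (borelRn R n).
Local Notation v := (variation_content Omega mu).

Let v_add : finitely_additive v. Proof. exact: variation_content_add. Qed.
Let v_ge0 A : measurable A -> 0 <= v A.
Proof. exact: variation_content_ge0. Qed.

Let null_nbhs x : ~ core Omega mu x ->
  exists V : set 'rV[R]_n, [/\ open V, V x & v V = 0].
Proof.
move=> /existsNP[V] /not_implyP[oV] /not_implyP[Vx nV].
exists V; split => //; have mV : measurable (V : set B) by exact: open_borel.
apply/eqP; rewrite eq_le v_ge0// andbT.
move/negP : nV; rewrite -leNgt setIC -variation_contentE//.
Qed.

Let null_open V : open V -> v V = 0 -> V `<=` ~` core Omega mu.
Proof.
move=> oV vV x Vx /(_ V oV Vx).
have mV : measurable (V : set B) by exact: open_borel.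
by rewrite setIC -variation_contentE// vV ltxx.
Qed.

Lemma core_closed : closed (core Omega mu).
Proof.
rewrite -(setCK (core Omega mu)) closedC openE => x /null_nbhs[V [oV Vx vV]].
by rewrite /interior nbhsE; exists V => //; exact: null_open.
Qed.

Lemma core_sub_closure : core Omega mu `<=` closure Omega.
Proof.
rewrite -[X in _ `<=` X]setCK; apply: subsetCr.
have oC : open (~` closure Omega) by rewrite openC; exact: closed_closure.
apply: null_open => //.
rewrite /variation_content (_ : Omega `&` _ = Omega `&` set0).
  exact: (fa_set0 v_add).
rewrite setI0; apply/seteqP; split => // x [Ox]; apply.
exact: subset_closure.
Qed.

(** Open null sets cover [K], and finitely many suffice by compactness. Finite additivity allows no
    passage to the whole complement of the core. *)
Lemma variation_compact_null (K : set 'rV[R]_n) : compact K ->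
  K `<=` ~` core Omega mu -> v K = 0.
Proof.
move=> cK KC.
have mK : measurable (K : set B).
  by apply: compact_borel => //; exact: norm_hausdorff.
move: (cK); rewrite compact_cover => /(_ _ [set V | open V /\ v V = 0] id).
case=> [V []//|x /KC /null_nbhs[V [oV Vx vV]]|D DV KD]; first by exists V.
move: KD; set C := cover _ _ => KD.
have [mD vD] : measurable (C : set B) /\ v C = 0.
  rewrite /C /cover bigcup_fset big_seq.
  elim/big_ind : _ => [|V W [mV vV] [mW vW]|V /DV].
  - by split => //; exact: (fa_set0 v_add).
  - have mVW := measurableU _ _ mV mW.
    split => //; apply/eqP; rewrite eq_le v_ge0// andbT.
    by apply: le_trans (fa_leU v_add v_ge0 mV mW) _; rewrite vV vW addr0.
  - by rewrite inE => -[oV vV]; split => //; exact: open_borel.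
by apply/eqP; rewrite eq_le v_ge0// andbT -vD; exact: (fa_le v_add v_ge0).
Qed.

End core.

(** * Representing measures concentrated on the core *)

Section representation.
Context (R : realType) (n : nat).
Variables (Omega : set 'rV[R]_n) (mu : set 'rV[R]_n -> R).
Hypotheses (bO : borel Omega) (mu_ba : ba Omega mu).
Hypothesis Omega_bounded : bounded_set Omega.
Local Notation B := (borelRn R n).
Local Notation v := (variation_content Omega mu).
Local Notation X := (closure Omega).

Lemma closure_bounded_compact : compact X.
Proof.
apply: bounded_closed_compact; last exact: closed_closure.
have [M [Mr HM]] := Omega_bounded; exists M; split => // r Mr'.
have /closure_id -> : closed [set x : 'rV[R]_n | `|x| <= r].
  apply: (@closed_comp _ _ (fun x : 'rV[R]_n => `|x|)) (@closed_le _ r).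
  by move=> x _; exact: norm_continuous.
by apply: closureS => x Ox; exact: HM.
Qed.

Let hT : hausdorff_space 'rV[R]_n. Proof. exact: norm_hausdorff. Qed.

(** The domination by [c * v] transfers null compact sets from [v] to [nu]; the constant will be 1
    for the variation itself and 2 for its difference with [mu]. *)
Lemma content_representation (nu : set B -> R) (c : R) :
  finitely_additive nu -> (forall A, measurable A -> 0 <= nu A) ->
  (forall A, measurable A -> nu A <= c * v A) ->
  exists lam : {finite_measure set B -> \bar R},
  [/\ lam (~` core Omega mu) = 0%E,
      forall (A : set 'rV[R]_n) (e : R), borel A -> 0 < e ->
        exists K U : set 'rV[R]_n, [/\ compact K, open U, K `<=` A, A `<=` U &
          (lam (U `\` K) <= e%:E)%E],
      forall K : set 'rV[R]_n, compact K -> ((nu K)%:E <= lam K)%E &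
      forall U : set 'rV[R]_n, open U -> (lam U <= (nu U)%:E)%E].
Proof.
move=> nu_add nu_ge0 nu_v.
have [lam [nulam lamnu reg]] :=
  content_to_measure hT (@pseudometric_normal R _) nu_add nu_ge0.
have oC : open (~` core Omega mu) by rewrite openC; exact: core_closed.
have lamC : lam (~` core Omega mu) = 0%E.
  apply/eqP; rewrite eq_le measure_ge0 andbT; apply: lamnu => // K cK KC.
  have mK : measurable (K : set B) by exact: compact_borel.
  by rewrite (le_trans (nu_v _ mK))// (variation_compact_null bO mu_ba)// mulr0.
have clX : closed X by exact: closed_closure.
exists lam; split => //.
- apply: (finite_measure_regular hT closure_bounded_compact) => //.
  apply/eqP; rewrite eq_le measure_ge0 andbT -lamC; apply: le_measure.
  + by rewrite inE; apply: open_borel; rewrite openC.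
  + by rewrite inE; exact: open_borel.
  + by apply: subsetC; exact: core_sub_closure.
- move=> U oU; apply: lamnu => // K cK KU; apply: (fa_le nu_add nu_ge0) => //.
    exact: compact_borel.
  exact: open_borel.
Qed.

End representation.

(** * The signed measure as a difference of two representing measures *)

Theorem proposition5p24 (R : realType) (n : nat) (Omega : set 'rV[R]_n)
    (Omega_bounded : bounded_set Omega) (Omega_borel : borel Omega)
    (mu : set 'rV[R]_n -> R) (mu_ba : ba Omega mu) :
  core Omega mu `<=` closure Omega /\
  exists sigma : {charge set (borelRn R n) -> \bar R},
    [/\ radon sigma,
        supported_on sigma (core Omega mu) &
        forall phi, Ce Omega phi ->
        forall psi, continuous_extension Omega phi psi ->
          (ba_integral Omega mu phi)%:E =
          charge_integral sigma (core Omega mu) psi].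
Proof.
have core_X := core_sub_closure Omega_borel mu_ba.
split => //.
pose m := trace_content Omega mu; pose v := variation_content Omega mu.
have m_add : finitely_additive m by exact: trace_content_add.
have v_add : finitely_additive v by exact: variation_content_add.
have v_ge0 (A : set (borelRn R n)) : measurable A -> 0 <= v A.
  exact: variation_content_ge0.
have m_v (A : set (borelRn R n)) : measurable A -> `|m A| <= v A.
  exact: norm_trace_content_le.
pose w (A : set (borelRn R n)) := v A - m A.
have w_add : finitely_additive w.
  by move=> A A' mA mA' AA'; rewrite /w v_add// m_add//; ring.
have w_ge0 A : measurable A -> 0 <= w A.
  by move=> mA; rewrite subr_ge0 (le_trans (ler_norm _))// m_v.
have v_le A : measurable A -> v A <= 1 * v A by rewrite mul1r.
have w_le A : measurable A -> w A <= 2 * v A.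
  by move=> mA; have := m_v _ mA; rewrite ler_norml /w => /andP[? ?]; lra.
have [lam1 [lam1C reg1 K1 U1]] :=
  content_representation Omega_borel mu_ba Omega_bounded v_add v_ge0 v_le.
have [lam2 [lam2C reg2 K2 U2]] :=
  content_representation Omega_borel mu_ba Omega_bounded w_add w_ge0 w_le.
have [sigma sigmaE] := charge_difference lam1 lam2.
have core_cl := core_closed Omega_borel mu_ba.
have m_core : measurable (core Omega mu : set (borelRn R n)).
  exact: closed_borel.
exists sigma; split.
- move=> A bA e e0.
  (* Two errors of [e / 4] add up to [e / 2], which turns the non-strict bounds for both measures
     into the strict one required. *)
  have e40 : 0 < e / 4 by rewrite divr_gt0.
  have [L1 [V1 [cL1 oV1 LA1 AV1 le1]]] := reg1 _ _ bA e40.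
  have [L2 [V2 [cL2 oV2 LA2 AV2 le2]]] := reg2 _ _ bA e40.
  have hT : hausdorff_space 'rV[R]_n by exact: norm_hausdorff.
  have mL1 := compact_borel hT cL1; have mL2 := compact_borel hT cL2.
  have mV1 := open_borel oV1; have mV2 := open_borel oV2.
  have mVL : measurable ((V1 `&` V2) `\` (L1 `|` L2) : set (borelRn R n)).
    by apply: measurableD; [exact: measurableI|exact: measurableU].
  exists (L1 `|` L2), (V1 `&` V2); split.
  + exact: compactU.
  + exact: openI.
  + by rewrite subUset.
  + by rewrite subsetI.
  apply: le_lt_trans (signed_variation_le sigmaE mVL) _.
  apply: (@le_lt_trans _ _ ((e / 4)%:E + (e / 4)%:E)%E); last first.
    by rewrite -EFinD lte_fin; lra.
  apply: leeD; [apply: le_trans le1|apply: le_trans le2];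
    (apply: le_measure; rewrite ?inE//; first exact: measurableD).
    by move=> x [[? ?] nL]; split => // ?; apply: nL; left.
  by move=> x [[? ?] nL]; split => // ?; apply: nL; right.
- have mC : measurable (~` core Omega mu : set (borelRn R n)).
    exact: measurableC.
  apply/eqP; rewrite eq_le; apply/andP; split.
    by apply: le_trans (signed_variation_le sigmaE mC) _;
      rewrite lam1C lam2C adde0.
  exact: measure_ge0.
move=> phi _ psi [psi_cont psi_phi].
have cX := closure_bounded_compact Omega_bounded.
have hT : hausdorff_space 'rV[R]_n by exact: norm_hausdorff.
have psi_core : {within core Omega mu, continuous psi}.
  exact: continuous_subspaceW psi_cont.
have mpsi : measurable_fun (core Omega mu : set (borelRn R n)) psi.
  exact: within_continuous_measurable.
have bpsi : [bounded psi x | x in core Omega mu].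
  have [M [Mr HM]] := compact_bounded (continuous_compact psi_cont cX).
  exists M; split => // r Mr' x Cx; apply: (HM r) => //.
  by exists x => //; exact: core_X.
have intpsi (nu : {finite_measure set (borelRn R n) -> \bar R}) :
    nu.-integrable (core Omega mu) (EFin \o psi).
  apply: measurable_bounded_integrable => //.
  by rewrite -ge0_fin_numE//; exact: fin_num_measure.
have finpsi (nu : {finite_measure set (borelRn R n) -> \bar R}) :
    (\int[nu]_(x in core Omega mu) (psi x)%:E)%E \is a fin_num.
  by apply: integrable_fin_num => //; exact: intpsi.
rewrite (charge_integral_difference sigmaE)//.
rewrite -(fineK (finpsi lam1)) -(fineK (finpsi lam2)) -EFinB; congr EFin.
apply: (ba_integral_eq Omega_borel mu_ba) => e e0.
have mXC : measurable (~` closure Omega : set (borelRn R n)).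
  by apply: open_borel; rewrite openC; exact: closed_closure.
have vX : v (~` closure Omega) = 0.
  rewrite /v /variation_content (_ : _ `&` _ = Omega `&` set0).
    exact: (fa_set0 v_add).
  rewrite setI0; apply/seteqP; split => // x [Ox]; apply.
  exact: subset_closure.
have wX : w (~` closure Omega) = 0.
  by apply/eqP; rewrite eq_le w_ge0// andbT (le_trans (w_le _ mXC))// vX mulr0.
(* Four errors, each [e / (c + 1)] times a total mass, separate [sint m s] from the difference of
   the integrals: content against measure and simple function against [psi], for each of the two
   measures. The summand 1 keeps the quotient well defined and at most [e]. *)
pose c := v setT + w setT + fine (lam1 setT) + fine (lam2 setT).
have c_ge0 : 0 <= c.
  apply: addr_ge0; last exact: fine_ge0.
  apply: addr_ge0; last exact: fine_ge0.
  by apply: addr_ge0; [exact: v_ge0|exact: w_ge0].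
have d_gt0 : 0 < e / (c + 1) by rewrite divr_gt0// ltr_wpDl.
have ed : e = e / (c + 1) * (c + 1) by rewrite divfK// gt_eqF// ltr_wpDl.
have [s [ss s_psi s_int]] := uniform_simple_approximation hT cX psi_cont d_gt0.
have s1 := s_int v lam1 v_add v_ge0 vX K1 U1.
have s2 := s_int w lam2 w_add w_ge0 wX K2 U2.
have s_core x : core Omega mu x -> `|s x - psi x| <= e / (c + 1).
  by move=> Cx; apply: s_psi; exact: core_X.
have t1 := integral_near_simple m_core ss lam1C (intpsi lam1) (ltW d_gt0)
  s_core.
have t2 := integral_near_simple m_core ss lam2C (intpsi lam2) (ltW d_gt0)
  s_core.
have de : e / (c + 1) <= e.
  by rewrite [leRHS]ed ler_pMr// lerDr.
exists s; split => //.
  move=> x Ox; rewrite -psi_phi//; apply: le_trans (s_psi x _) de.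
  exact: subset_closure.
have -> : sint m s = sint v s - sint w s.
  rewrite -sint_subr//; congr sint; apply/funext => A.
  by rewrite /w opprB addrC subrK.
rewrite [leRHS]ed; move: s1 s2 t1 t2; rewrite !ler_norml.
have := d_gt0; rewrite /c.
move=> ? /andP[? ?] /andP[? ?] /andP[? ?] /andP[? ?].
apply/andP; split; lra.
Qed.
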